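(* Let $\lambda>0$, $\alpha>0$, $\theta>0$. Let $z(t)=\sum_{k=1}^{N(t)}\xi_k$ be a compound Poisson process, where $N=(N(t))_{t\ge 0}$ is a Poisson process with rate $\alpha$ and $(\xi_k)_{k\ge1}$ are i.i.d. exponential random variables with rate $\theta$ (density $\theta e^{-\theta x}$ on $x>0$), independent of $N$. Let $\sigma^2(t)$ be the stationary solution of $$d\sigma^2(t)=-\lambda\,\sigma^2(t)\,dt+dz(\lambda t).$$ Then the stationary marginal distribution of $\sigma^2(t)$ is the Gamma distribution $\Gamma(\alpha,\theta)$ with shape $\alpha$ and rate $\theta$.
   Context: The equation $d\sigma^2(t)=-\lambda\sigma^2(t)\,dt+dz(\lambda t)$ is an Ornstein–Uhlenbeck type equation driven by $z$ (the background driving Lévy process); its solutions satisfy $\sigma^2(t+u)=e^{-\lambda u}\sigma^2(t)+\int_{t}^{t+u}e^{-\lambda(t+u-s)}\,dz(\lambda s)$ for $t,u\ge 0$, with $\sigma^2(0)$ independent of $(z(s))_{s\ge0}$. A solution is stationary if the law of $\sigma^2(t)$ does not depend on $t$; this common law is the stationary marginal distribution. In this statement $\Gamma(\alpha,\theta)$ denotes the law with characteristic function $\xi\mapsto(1-i\theta^{-1}\xi)^{-\alpha}$. *)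

(* Defs.v *)
From HB Require Import structures.
From mathcomp Require Import all_boot all_order all_algebra.
From mathcomp Require Import all_classical all_reals all_analysis.
From mathcomp Require Import complex.

Set Implicit Arguments.
Unset Strict Implicit.
Unset Printing Implicit Defensive.

Import Order.TTheory GRing.Theory Num.Theory.
Import numFieldNormedType.Exports.

Local Open Scope classical_set_scope.
Local Open Scope ring_scope.
Local Open Scope complex_scope.

Section complex_power.
Context {R : realType}.
Implicit Types (z : R[i]) (a : R).

Local Notation cmod := ComplexField.Normc.normc.

(* Principal argument, with values in ]-pi, pi] *)
Definition carg z : R :=
  if 0 <= complex.Im z then acos (complex.Re z / cmod z)
  else - acos (complex.Re z / cmod z).

(* Principal branch: exp (a * Log z) for z != 0 *)
Definition cpowR z a : R[i] :=
  (cmod z `^ a * cos (a * carg z)) +i* (cmod z `^ a * sin (a * carg z)).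

End complex_power.

Section laws.
Context {R : realType}.

(* \int exp(i u x) mu(dx), the complex exponential being split into its real
   and imaginary parts because the library integrates real functions. *)
Definition charfun (mu : probability R R) (u : R) : R[i] :=
  (\int[mu]_x cos (u * x)) +i* (\int[mu]_x sin (u * x)).

(* Gamma(alpha, theta) is the law whose characteristic function is
   u |-> (1 - i u / theta)^(- alpha). *)
Definition is_gamma_law (alpha theta : R) (mu : probability R R) : Prop :=
  forall u : R, charfun mu u = cpowR (1 -i* (theta^-1 * u)) (- alpha).

End laws.

Section independence.
Context {d : measure_display} {T : measurableType d} {R : realType}.
Variable P : probability T R.

Definition indep_classes (F G : set_system T) : Prop :=
  forall A B, F A -> G B -> P (A `&` B) = (P A * P B)%E.

Definition mutually_independent {d' : measure_display} {E : measurableType d'}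
    {I : eqType} (X : I -> T -> E) : Prop :=
  forall (s : seq I) (A : I -> set E), uniq s ->
    (forall i, measurable (A i)) ->
    P (\bigcap_(i in [set` s]) X i @^-1` A i)
      = (\prod_(i <- s) P (X i @^-1` A i))%E.

(* sigma(X t, t in D) *)
Definition process_sigma_algebra {d' : measure_display} {E : measurableType d'}
    {I : Type} (D : set I) (X : I -> T -> E) : set_system T :=
  <<s \bigcup_(t in D) g_sigma_algebra_preimage (X t) >>.

End independence.

Section processes.
Context {d : measure_display} {T : measurableType d} {R : realType}.
Variable P : probability T R.

(* Processes indexed by [0, +oo[ are represented by families indexed by R, of
   which only the members with nonnegative index are constrained or used. *)

(* The subtraction on nat below is truncated; this is harmless since the paths
   are almost surely nondecreasing. *)
Record poisson_process (rate : R) (N : R -> {RV P >-> nat}) : Prop := {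
  poisson_process_path : {ae P, forall w,
    [/\ N 0 w = 0%N,
        (forall s t : R, 0 <= s -> s <= t -> (N s w <= N t w)%N) &
        forall t : R, 0 <= t -> N s w @[s --> t^'+] --> N t w]} ;
  poisson_process_indep : forall t : nat -> R,
    0 <= t 0%N -> (forall i, t i <= t i.+1) ->
    mutually_independent P (fun i w => (N (t i.+1) w - N (t i) w)%N) ;
  poisson_process_law : forall (s t : R) (k : nat), 0 <= s -> s < t ->
    P [set w | (N t w - N s w)%N = k] = (poisson_pmf (rate * (t - s)) k)%:E
}.

Record iid_exponential (rate : R) (xi : nat -> {RV P >-> R}) : Prop := {
  iid_exponential_indep : mutually_independent P (fun k => xi k : T -> R) ;
  iid_exponential_law : forall k (A : set R), measurable A ->
    distribution P (xi k) A = exponential_prob rate A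
}.

(* The jumps xi_1, xi_2, ... are numbered from 0. *)
Definition compound_poisson (N : R -> {RV P >-> nat})
    (xi : nat -> {RV P >-> R}) (t : R) (w : T) : R :=
  \sum_(k < N t w) xi k w.

(* Integrated form, along one path, of  dx(t) = - lambda x(t) dt + dz(lambda t).
   Variation of constants turns it into
   x(t + u) = exp(- lambda u) x(t)
              + \int_(t, t + u] exp(- lambda (t + u - s)) dz(lambda s). *)
Definition OU_path (lambda : R) (z x : R -> R) : Prop :=
  forall t : R, 0 <= t ->
    (@lebesgue_measure R).-integrable `[0, t] (EFin \o x) /\
    x t = x 0 - lambda * (\int[lebesgue_measure]_(s in `[0, t]) x s)
          + (z (lambda * t) - z 0).

Record OU_solution (lambda : R) (z : R -> T -> R) (X : R -> {RV P >-> R}) :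
    Prop := {
  OU_solution_path : {ae P, forall w, OU_path lambda (z ^~ w) (X ^~ w)} ;
  OU_solution_init : indep_classes P (g_sigma_algebra_preimage (X 0))
    (process_sigma_algebra [set s | 0 <= s] z)
}.

Definition stationary (X : R -> {RV P >-> R}) : Prop :=
  forall (t : R) (A : set R), 0 <= t -> measurable A ->
    distribution P (X t) A = distribution P (X 0) A.

End processes.

(* Main.v *)
Require Import Defs.
From HB Require Import structures.
From mathcomp Require Import all_boot all_order all_algebra.
From mathcomp Require Import all_classical all_reals all_analysis.
From mathcomp Require Import measurable_realfun complex ring lra.
Import Order.TTheory GRing.Theory Num.Theory.
Import numFieldNormedType.Exports.
Local Open Scope classical_set_scope.
Local Open Scope ring_scope.

(* Write [phi] for the characteristic function of [sigma2 0], [c + i s] for that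
   of a jump, and [a = lambda h].  For small [h] the OU equation gives
   [sigma2 h = exp (- a) sigma2 0 + z a] up to an error at most [2 a |z a|] on
   the event of at most one jump, whose complement has probability [O(a^2)].
   Since [z a] is independent of [sigma2 0], stationarity yields
     phi(v) = phi(exp (- a) v) (1 + alpha a (c(v) - 1 + i s(v))) + O(a^2),
   so [t |-> phi(exp t * u)] solves a linear ODE, also solved by the
   characteristic function of the Gamma law, and both tend to 1 at -oo. *)

(** No moment of [sigma2 0] is assumed, so [phi] cannot be differentiated under the integral sign;
    its differentiability is extracted from the recursion itself. The contraction
    [v |-> exp (- a) v] is multiplicative, and putting [v = exp t * u] turns it into the translation
    [t |-> t - a]; an error [O(a^2)] that is uniform for [t] in a bounded interval then yields a
    derivative. With [y = v / theta] a jump has characteristic function [1 / (1 - i y)], so the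
    equation has coefficient [alpha (1 / (1 - i y) - 1)] and [(1 - i y)^alpha] is an integrating
    factor; this replaces a general uniqueness theorem. Complex numbers are avoided by carrying a
    free phase: the expectation of [cos (v * X + p)] is the real part of [exp (i p) phi(v)], and
    replacing [p] by [p - pi / 2] turns the cosine into a sine. One estimate for cosines thus serves
    both parts, and every integrand stays bounded. *)

(** * Bounded integrands and independence *)

Lemma bounded_integrable {d} {T : measurableType d} {R : realType}
    (P : probability T R) (f : T -> R) (M : R) :
  measurable_fun setT f -> (forall w, `|f w| <= M) ->
  P.-integrable setT (EFin \o f).
Proof.
move=> mf fM; apply: measurable_bounded_integrable => //.
  by rewrite -ge0_fin_numE ?fin_num_measure.
exists M; split; first exact: num_real.
by move=> x Mx w _; exact: le_trans (fM w) (ltW Mx).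
Qed.

Lemma normr_Rintegral_le {d} {T : measurableType d} {R : realType}
    (P : probability T R) (f : T -> R) (M : R) :
  measurable_fun setT f -> (forall w, `|f w| <= M) ->
  `|\int[P]_w f w| <= M.
Proof.
move=> mf fM; have M_ge0 : 0 <= M by exact: le_trans (fM point).
apply: (le_trans (le_normr_Rintegral _ _)) => //.
  exact: bounded_integrable fM.
rewrite -[leRHS]mulr1 -[1]/(fine 1%:E) -(probability_setT P) -Rintegral_cst//.
apply: le_Rintegral => //.
- apply: (@bounded_integrable _ _ _ _ _ M); first exact: measurableT_comp.
  by move=> w; rewrite normr_id.
- by apply: (@bounded_integrable _ _ _ _ _ M) => // w; rewrite ger0_norm.
Qed.

(** Independence on rectangles identifies the law of the pair [(X, Y)] with the product of the two
    laws, by uniqueness of the product measure. Fubini then splits the integral, boundedness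
    providing integrability. *)
Lemma indep_Rintegral_mul {d} {T : measurableType d} {R : realType}
    (P : probability T R) {d1 d2} {T1 : measurableType d1}
    {T2 : measurableType d2} (X : T -> T1) (Y : T -> T2)
    (f : T1 -> R) (g : T2 -> R) (Mf Mg : R) :
  measurable_fun setT X -> measurable_fun setT Y ->
  (forall A B, measurable A -> measurable B ->
    P (X @^-1` A `&` Y @^-1` B) = (P (X @^-1` A) * P (Y @^-1` B))%E) ->
  measurable_fun setT f -> measurable_fun setT g ->
  (forall x, `|f x| <= Mf) -> (forall y, `|g y| <= Mg) ->
  \int[P]_w (f (X w) * g (Y w)) = (\int[P]_w f (X w)) * (\int[P]_w g (Y w)).
Proof.
move=> mX mY XY mf mg fM gM.
pose X' : {RV P >-> T1} := HB.pack X (@isMeasurableFun.Build _ _ _ _ X mX).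
pose Y' : {RV P >-> T2} := HB.pack Y (@isMeasurableFun.Build _ _ _ _ Y mY).
have mXY : measurable_fun setT (fun w => (X w, Y w)).
  exact: measurable_fun_pair.
pose Z : {RV P >-> (T1 * T2)%type} :=
  HB.pack (fun w => (X w, Y w)) (@isMeasurableFun.Build _ _ _ _ _ mXY).
pose fg (z : T1 * T2) := f z.1 * g z.2.
have mfg : measurable_fun setT fg.
  by apply: measurable_funM; exact: measurableT_comp.
have fgM z : `|fg z| <= Mf * Mg by rewrite normrM ler_pM.
have ifg : P.-integrable setT (EFin \o (fun w => f (X w) * g (Y w))).
  apply: (@bounded_integrable _ _ _ _ _ (Mf * Mg)).
    by apply: (measurableT_comp mfg mXY).
  by move=> w; exact: (fgM (X w, Y w)).
pose m1 := distribution P X'; pose m2 := distribution P Y'.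
have prodE A : measurable A -> (m1 \x m2)%E A = distribution P Z A.
  apply: product_measure_unique => B C mB mC.
  by rewrite -XY.
have E1 : (\int[P]_w (f (X w) * g (Y w))%:E)%E
    = (\int[(m1 \x m2)%E]_z (fg z)%:E)%E.
  rewrite -(@integral_distribution _ _ _ _ _ P Z (EFin \o fg))//; last first.
    exact/measurable_EFinP.
  by apply: eq_measure_integral => A mA _; exact/esym/prodE.
have i2 : (m1 \x m2)%E.-integrable setT (EFin \o fg).
  exact: (@bounded_integrable _ _ _ (m1 \x m2)%E _ _ mfg fgM).
have ig : m2.-integrable setT (EFin \o g) by exact: bounded_integrable gM.
have if_ : m1.-integrable setT (EFin \o f) by exact: bounded_integrable fM.
have gY : \int[P]_w g (Y w) = \int[m2]_y g y.
  rewrite /Rintegral (@integral_distribution _ _ _ _ _ P Y' (EFin \o g))//.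
    exact/measurable_EFinP.
  by apply: (@bounded_integrable _ _ _ _ _ Mg) => //; exact: measurableT_comp.
have fX : \int[P]_w f (X w) = \int[m1]_x f x.
  rewrite /Rintegral (@integral_distribution _ _ _ _ _ P X' (EFin \o f))//.
    exact/measurable_EFinP.
  by apply: (@bounded_integrable _ _ _ _ _ Mf) => //; exact: measurableT_comp.
rewrite {1}/Rintegral E1 -integral12_prod_meas1// gY fX -RintegralZr//.
rewrite [RHS]/Rintegral; congr fine; apply: eq_integral => x _.
rewrite /fubini_F /fg /=.
under eq_integral do rewrite EFinM.
rewrite integralZl// EFinM; congr (_ * _)%E.
by rewrite /Rintegral fineK//; exact: integrable_fin_num.
Qed.

(** * Pathwise estimate for the OU equation over a short time *)

Lemma continuous_expR_linear {R : realType} (k : R) :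
  continuous (fun s : R => expR (k * s)).
Proof.
move=> s; apply: continuous_comp; last exact: continuous_expR.
by apply: cvgM; [exact: cvg_cst|exact: cvg_id].
Qed.

Lemma Rintegral_expR_decay {R : realType} (lambda t : R) : 0 <= t ->
  lambda * (\int[lebesgue_measure]_(s in `[0, t]) expR (- lambda * s)) =
  1 - expR (- lambda * t).
Proof.
rewrite le_eqVlt => /predU1P[<-|t_gt0].
  by rewrite set_itv1 Rintegral_set1 !mulr0 expR0 subrr.
have cexp : continuous (fun s : R => lambda * expR (- lambda * s)).
  by move=> s; apply: cvgM; [exact: cvg_cst|exact: continuous_expR_linear].
have cF : continuous (fun s : R => - expR (- lambda * s)).
  by move=> s; apply: cvgN; exact: continuous_expR_linear.
rewrite -RintegralZl//; last first.
  apply: continuous_compact_integrable; first exact: segment_compact.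
  by apply: continuous_subspaceT; exact: continuous_expR_linear.
rewrite /Rintegral (@continuous_FTC2 _ _ (fun s => - expR (- lambda * s)))//=.
- by rewrite mulr0 expR0 opprK addrC.
- exact: continuous_subspaceT.
- split.
  + by move=> s _; exact: ex_derive.
  + by apply/cvg_at_right_filter; exact: cF.
  + by apply/cvg_at_left_filter; exact: cF.
- move=> s _; rewrite derive1E.
  by apply: derive_val; apply: is_derive_eq; rewrite /GRing.scale/=; ring.
Qed.

(** Subtracting the homogeneous solution leaves [y] with [y t = - lambda * \int y + z (lambda * t)],
    so the quantity to bound is [lambda * \int y] over [[0, h]]. A one-step Gronwall argument
    suffices: if [K] is the integral of [|y|], then [|y| <= lambda * K + M], hence
    [K <= (lambda * K + M) * h]. Since [lambda * h <= 1/2], the term in [K] is absorbed and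
    [K <= 2 * h * M]. *)
Lemma OU_path_increment {R : realType} (lambda h M : R) (z x : R -> R) :
  0 < lambda -> 0 <= h -> lambda * h <= 2^-1 -> OU_path lambda z x ->
  z 0 = 0 -> (forall s, 0 <= s <= lambda * h -> `|z s| <= M) ->
  `|x h - expR (- (lambda * h)) * x 0 - z (lambda * h)| <= 2 * (lambda * h) * M.
Proof.
move=> lambda_gt0 h_ge0 lambdah OU z0 zM.
pose y t := x t - expR (- lambda * t) * x 0.
have iexp t : lebesgue_measure.-integrable `[0, t]
    (EFin \o (fun s : R => expR (- lambda * s) * x 0)).
  apply: continuous_compact_integrable; first exact: segment_compact.
  apply: continuous_subspaceT => s.
  by apply: cvgM; [exact: continuous_expR_linear|exact: cvg_cst].
have iexp' t : lebesgue_measure.-integrable `[0, t]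
    (EFin \o (fun s : R => expR (- lambda * s))).
  apply: continuous_compact_integrable; first exact: segment_compact.
  by apply: continuous_subspaceT; exact: continuous_expR_linear.
have iy t : 0 <= t -> lebesgue_measure.-integrable `[0, t] (EFin \o y).
  by move=> /OU[ix _]; exact: (integrableB _ ix (iexp t)).
have yE t : 0 <= t ->
    y t = - (lambda * \int[lebesgue_measure]_(s in `[0, t]) y s)
      + z (lambda * t).
  move=> t_ge0; have [ix xE] := OU _ t_ge0.
  rewrite (RintegralB _ ix (iexp t))//.
  rewrite (RintegralZr _ _ (iexp' t))//.
  rewrite mulrBr mulrA Rintegral_expR_decay// /y [in LHS]xE z0; ring.
have inorm t : 0 <= t ->
    lebesgue_measure.-integrable `[0, t] (EFin \o (fun s => `|y s|)).
  by move=> t_ge0; have /integrable_abse := iy t t_ge0.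
set K := \int[lebesgue_measure]_(s in `[0, h]) `|y s|.
have intyK t : 0 <= t <= h ->
    `|\int[lebesgue_measure]_(s in `[0, t]) y s| <= K.
  move=> /andP[t_ge0 th].
  apply: (le_trans (le_normr_Rintegral _ _)) => //; first exact: iy.
  rewrite /K /Rintegral fine_le//.
  - by apply: integrable_fin_num => //; exact: inorm.
  - by apply: integrable_fin_num => //; exact: inorm.
  apply: ge0_subset_integral => //.
  - by have /integrableP[] := inorm h h_ge0.
  - by apply: subset_itvl; rewrite bnd_simp.
have yKM t : 0 <= t <= h -> `|y t| <= lambda * K + M.
  move=> /andP[t_ge0 th]; rewrite yE//.
  apply: (le_trans (ler_normD _ _)); rewrite normrN normrM gtr0_norm//.
  apply: lerD; first by rewrite ler_pM2l// intyK ?t_ge0.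
  by apply: zM; rewrite mulr_ge0 ?(ltW lambda_gt0)//= ler_pM2l.
have K_le : K <= (lambda * K + M) * h.
  apply: (@le_trans _ _
      (\int[lebesgue_measure]_(s in `[0, h]) (lambda * K + M))).
    apply: le_Rintegral => //; first exact: inorm.
    apply: continuous_compact_integrable; first exact: segment_compact.
    by apply: continuous_subspaceT; exact: cst_continuous.
  rewrite (Rintegral_cst lebesgue_measure)//=.
  rewrite lebesgue_measure_itv/= lte_fin.
  case: ltP => [_|h_le0] /=; first by rewrite oppr0 addr0.
  by rewrite (_ : h = 0)//; apply/le_anti; rewrite h_ge0 h_le0.
have K_ge0 : 0 <= K by apply: Rintegral_ge0.
have -> : x h - expR (- (lambda * h)) * x 0 = y h by rewrite /y mulNr.
rewrite yE// addrK normrN normrM gtr0_norm//.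
apply: (@le_trans _ _ (lambda * K)).
  by rewrite ler_pM2l// intyK// h_ge0 lexx.
suff : K <= 2 * h * M by rewrite -(ler_pM2l lambda_gt0); nra.
nra.
Qed.

(** * Trigonometric functions and expectations of an exponential variable *)

Lemma measurable_affine {R : realType} (v p : R) :
  measurable_fun setT (fun x : R => v * x + p).
Proof.
apply: continuous_measurable_fun => x.
by apply: cvgD; [apply: cvgM; [exact: cvg_cst|exact: cvg_id]|exact: cvg_cst].
Qed.

Lemma measurable_cos {R : realType} : measurable_fun setT (@cos R).
Proof. by apply: continuous_measurable_fun; exact: continuous_cos. Qed.

Lemma measurable_sin {R : realType} : measurable_fun setT (@sin R).
Proof. by apply: continuous_measurable_fun; exact: continuous_sin. Qed.

Section exponential_expectation.
Context {d : measure_display} {T : measurableType d} {R : realType}.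
Variables (P : probability T R) (theta : R) (X : {RV P >-> R}).
Hypothesis theta_gt0 : 0 < theta.
Hypothesis X_exp : forall A : set R, measurable A ->
  distribution P X A = exponential_prob theta A.

(** The hypothesis gives the law only as a set function. Its Radon-Nikodym derivative agrees almost
    everywhere with [exponential_pdf theta], both having the same integral over every measurable
    set, and the change of variables for that derivative does the rest. *)
Lemma Rintegral_exponential (f : R -> R) (M : R) :
  measurable_fun setT f -> (forall x, `|f x| <= M) ->
  \int[P]_w f (X w) =
  \int[lebesgue_measure]_x (f x * exponential_pdf theta x).
Proof.
move=> mf fM.
(* The Lebesgue measure lives on [measurableTypeR R], whose display differs from
   that of [R]. *)
pose X' : T -> measurableTypeR R := X.
have mX' : measurable_fun setT X'.
  by move=> _ B mB; exact: (@measurable_funPT _ _ _ _ X measurableT B mB).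
pose X'' : {RV P >-> measurableTypeR R} :=
  HB.pack X' (@isMeasurableFun.Build _ _ _ _ X' mX').
pose nu := distribution P X''.
have nuE A : measurable A ->
    nu A = (\int[lebesgue_measure]_(x in A) (exponential_pdf theta x)%:E)%E.
  exact: X_exp.
have ipdf := integrable_exponential_pdf theta_gt0.
have numu : nu `<< (@lebesgue_measure R).
  apply/null_content_dominatesP => A mA A0; rewrite nuE//.
  apply: null_set_integral => //.
  by apply: measurable_funTS; exact: (measurable_int _ ipdf).
have inu : nu.-integrable setT (EFin \o f).
  exact: (@bounded_integrable _ (measurableTypeR R) _ nu f M).
have mpdf : measurable_fun setT (EFin \o @exponential_pdf R theta).
  by apply/measurable_EFinP; exact: measurable_exponential_pdf.
rewrite /Rintegral; congr fine.
transitivity (\int[nu]_x (f x)%:E)%E.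
  rewrite (integral_distribution (X := X'') (f := EFin \o f))//.
    exact/measurable_EFinP.
  apply: (@bounded_integrable _ _ _ _ _ M) => //.
  exact: measurableT_comp.
rewrite -(Radon_Nikodym_change_of_variables numu)//=.
apply: ae_eq_integral => //.
- apply: emeasurable_funM; first exact/measurable_EFinP.
  by apply: (measurable_int lebesgue_measure); exact: Radon_Nikodym_integrable.
- apply/measurable_EFinP; apply: measurable_funM => //.
  exact: measurable_exponential_pdf.
- under [X in ae_eq _ _ _ X]eq_fun do rewrite EFinM.
  apply: ae_eqe_mul2l; apply: integral_ae_eq => //.
    exact: Radon_Nikodym_integrable.
  move=> E _ mE; rewrite -Radon_Nikodym_integral//=.
  exact: nuE.
Qed.

(* [g] is chosen so that [expR (- theta * x) * g x] is a primitive of [f] times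
   the exponential density. *)
Lemma Rintegral_exponential_primitive (f g : R -> R) (M B : R) :
  continuous f -> (forall x, 0 <= f x) -> (forall x, `|f x| <= M) ->
  (forall x, `|g x| <= B) ->
  (forall x, is_derive x (1 : R) g (theta * (g x + f x))) ->
  \int[P]_w f (X w) = - g 0.
Proof.
move=> cf f0 fM gB dg.
have mf : measurable_fun setT f by exact: continuous_measurable_fun.
rewrite (Rintegral_exponential f M mf fM).
rewrite (_ : (fun x => f x * exponential_pdf theta x) =
    (fun x => f x * (theta * expR (- theta * x))) \_ `[0, +oo[); last first.
  apply/funext => x; rewrite /exponential_pdf !patchE.
  by case: ifPn => // _; rewrite mulr0.
rewrite -Rintegral_mkcond.
have dexp (x : R) : is_derive x (1 : R) (fun x => expR (- theta * x))
    (- theta * expR (- theta * x)).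
  by apply: is_derive_eq; rewrite /GRing.scale/=; ring.
pose F x := expR (- theta * x) * g x.
have dF (x : R) : is_derive x (1 : R) F (f x * (theta * expR (- theta * x))).
  by apply: is_derive_eq; rewrite /GRing.scale/=; ring.
have cF : continuous F.
  move=> x; apply: differentiable_continuous; apply/derivable1_diffP.
  exact: ex_derive.
(* As [g] is bounded, the primitive [F] vanishes at [+oo], and the integral is [0 - F 0 = - g 0]. *)
rewrite (@Rintegral_ge0_continuous_FTC2y _ _ F _ 0).
- by rewrite /F mulr0 expR0 mul1r sub0r.
- by move=> x _; rewrite mulr_ge0// mulr_ge0 ?expR_ge0// ltW.
- apply: continuous_subspaceT => x; apply: cvgM; first exact: cf.
  by apply: cvgM; [exact: cvg_cst|exact: continuous_expR_linear].
- have exp0 : expR (- theta * x) @[x --> +oo] --> (0 : R).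
    rewrite (_ : (fun x => expR (- theta * x)) =
               (fun z => expR (- z)) \o (fun z => theta * z)); last first.
      by apply: eq_fun => x; rewrite mulNr.
    apply: (@cvg_comp _ _ _ _ _ _ (pinfty_nbhs R)); last exact: cvgr_expR.
    exact: gt0_cvgMry.
  apply/norm_cvg0P.
  apply: (@squeeze_cvgr _ _ _ _ (cst 0) (fun x => B * expR (- theta * x))).
  + apply: nearW => x; rewrite normr_ge0/= normrM ger0_norm ?expR_ge0// mulrC.
    by rewrite ler_wpM2r ?expR_ge0.
  + exact: cvg_cst.
  + by rewrite -[X in _ --> X](mulr0 B); apply: cvgM => //; exact: cvg_cst.
- by move=> x _; exact: ex_derive.
- by apply: cvg_at_right_filter; exact: cF.
- by move=> x _; rewrite derive1E; exact: derive_val.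
Qed.

Lemma Rintegral_exponential_cos (v : R) :
  \int[P]_w cos (v * X w) = theta ^+ 2 / (theta ^+ 2 + v ^+ 2).
Proof.
have D0 : theta ^+ 2 + v ^+ 2 != 0.
  by rewrite gt_eqF// ltr_pwDl ?sqr_ge0// exprn_gt0.
have ccos : continuous (fun x : R => cos (v * x)).
  move=> x; apply: continuous_comp; last exact: continuous_cos.
  by apply: cvgM; [exact: cvg_cst|exact: cvg_id].
have icos : P.-integrable setT (EFin \o (fun w => cos (v * X w))).
  apply: (@bounded_integrable _ _ _ _ _ 1) => [|w]; last exact: cos_max.
  by apply: (@measurableT_comp _ _ _ _ _ _ (fun x : R => cos (v * x))) => //;
    exact: continuous_measurable_fun.
have icst : P.-integrable setT (EFin \o (fun=> 1 : R)).
  by apply: (@bounded_integrable _ _ _ _ _ 1) => // w; rewrite normr1.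
(* The shift by [1] makes the integrand nonnegative, as the primitive rule demands. In the witness
   for [g], the constant [-1] balances this shift, and the trigonometric part comes from the usual
   primitive of [expR (- theta * x) * cos (v * x)]. *)
have : \int[P]_w (1 + cos (v * X w)) = 1 + theta ^+ 2 / (theta ^+ 2 + v ^+ 2).
  pose k := theta / (theta ^+ 2 + v ^+ 2).
  apply: etrans (@Rintegral_exponential_primitive (fun x => 1 + cos (v * x))
    (fun x => -1 + k * (- theta * cos (v * x) + v * sin (v * x)))
    2 (1 + `|k| * (`|theta| + `|v|)) _ _ _ _ _) _.
  - by move=> x; apply: cvgD; [exact: cvg_cst|exact: ccos].
  - by move=> x; rewrite -[leLHS](subrr 1) lerD2l cos_geN1.
  - by move=> x; rewrite (le_trans (ler_normD _ _))// normr1 lerD2l cos_max.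
  - move=> x; rewrite (le_trans (ler_normD _ _))// normrN1 lerD2l normrM.
    rewrite ler_wpM2l// (le_trans (ler_normD _ _))// !normrM normrN.
    by rewrite lerD// ler_piMr// ?cos_max ?sin_max.
  - move=> x; apply: is_derive_eq; rewrite /GRing.scale/= /k; field.
    exact: D0.
  - by rewrite mulr0 cos0 sin0 /k; field.
rewrite RintegralD// Rintegral_cst//.
rewrite [X in fine X](_ : _ = 1%E); last exact: probability_setT.
by rewrite /= mulr1 => /addrI.
Qed.

Lemma Rintegral_exponential_sin (v : R) :
  \int[P]_w sin (v * X w) = theta * v / (theta ^+ 2 + v ^+ 2).
Proof.
have D0 : theta ^+ 2 + v ^+ 2 != 0.
  by rewrite gt_eqF// ltr_pwDl ?sqr_ge0// exprn_gt0.
have csin : continuous (fun x : R => sin (v * x)).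
  move=> x; apply: continuous_comp; last exact: continuous_sin.
  by apply: cvgM; [exact: cvg_cst|exact: cvg_id].
have isin : P.-integrable setT (EFin \o (fun w => sin (v * X w))).
  apply: (@bounded_integrable _ _ _ _ _ 1) => [|w]; last exact: sin_max.
  by apply: (@measurableT_comp _ _ _ _ _ _ (fun x : R => sin (v * x))) => //;
    exact: continuous_measurable_fun.
have icst : P.-integrable setT (EFin \o (fun=> 1 : R)).
  by apply: (@bounded_integrable _ _ _ _ _ 1) => // w; rewrite normr1.
have : \int[P]_w (1 + sin (v * X w)) = 1 + theta * v / (theta ^+ 2 + v ^+ 2).
  pose k := theta / (theta ^+ 2 + v ^+ 2).
  apply: etrans (@Rintegral_exponential_primitive (fun x => 1 + sin (v * x))
    (fun x => -1 + k * (- theta * sin (v * x) - v * cos (v * x)))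
    2 (1 + `|k| * (`|theta| + `|v|)) _ _ _ _ _) _.
  - by move=> x; apply: cvgD; [exact: cvg_cst|exact: csin].
  - by move=> x; rewrite -[leLHS](subrr 1) lerD2l sin_geN1.
  - by move=> x; rewrite (le_trans (ler_normD _ _))// normr1 lerD2l sin_max.
  - move=> x; rewrite (le_trans (ler_normD _ _))// normrN1 lerD2l normrM.
    rewrite ler_wpM2l// (le_trans (ler_normB _ _))// !normrM normrN.
    by rewrite lerD// ler_piMr// ?cos_max ?sin_max.
  - move=> x; apply: is_derive_eq; rewrite /GRing.scale/= /k; field.
    exact: D0.
  - by rewrite mulr0 cos0 sin0 /k; field.
rewrite RintegralD// Rintegral_cst//.
rewrite [X in fine X](_ : _ = 1%E); last exact: probability_setT.
by rewrite /= mulr1 => /addrI.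
Qed.

(** Half of the exponential decay absorbs the factor [x], because [(theta / 2 * x) * expR (- (theta
    / 2) * x) <= 1]. What remains is [4 * c / theta] times the exponential density of rate
    [theta / 2], of total mass 1; the constant need not be the sharp [c / theta]. *)
Lemma Rintegral_exponential_le (f : R -> R) (M c : R) :
  measurable_fun setT f -> (forall x, `|f x| <= M) -> 0 <= c ->
  (forall x, 0 <= f x <= c * `|x|) -> \int[P]_w f (X w) <= 4 * c / theta.
Proof.
move=> mf fM c0 fc; rewrite (Rintegral_exponential f M mf fM).
have th2 : 0 < theta / 2 by rewrite divr_gt0.
have ipdf := integrable_exponential_pdf th2.
have ige x : f x * exponential_pdf theta x
    <= 4 * c / theta * exponential_pdf (theta / 2) x.
  have [x0|x0] := leP 0 x; last by rewrite !lt0_exponential_pdf// !mulr0.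
  rewrite !exponential_pdfE//.
  have /andP[_ fx] := fc x; rewrite ger0_norm// in fx.
  set e := expR (- (theta / 2) * x).
  have -> : expR (- theta * x) = e * e by rewrite -expRD; congr expR; field.
  have e0 : 0 < e by exact: expR_gt0.
  have xe : (theta / 2 * x) * e <= 1.
    rewrite /e mulNr expRN -ler_pdivlMr ?invr_gt0 ?expR_gt0// invrK mul1r.
    by apply: le_trans (expR_ge1Dx _); rewrite lerDr.
  apply: (@le_trans _ _ ((c * x) * (theta * (e * e)))).
    by apply: ler_wpM2r fx; rewrite !mulr_ge0// ltW.
  rewrite (_ : c * x * _ = 2 * c * e * (theta / 2 * x * e)); last by field.
  rewrite [leRHS](_ : _ = 2 * c * e * 1); last by field; rewrite gt_eqF.
  by apply: ler_wpM2l xe; rewrite !mulr_ge0// ltW.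
apply: (@le_trans _ _ (\int[lebesgue_measure]_x
    (4 * c / theta * exponential_pdf (theta / 2) x))).
  have ir : lebesgue_measure.-integrable setT
      (EFin \o (fun x => 4 * c / theta * exponential_pdf (theta / 2) x)).
    exact: integrableZl ipdf.
  apply: le_Rintegral => //.
  apply: le_integrable ir => //.
    apply/measurable_EFinP; apply: measurable_funM => //.
    exact: measurable_exponential_pdf.
  move=> x _; rewrite /= lee_fin !ger0_norm// ?mulr_ge0 ?exponential_pdf_ge0//.
  + by rewrite invr_ge0 ltW.
  + exact: ltW.
  + by have /andP[] := fc x.
  + exact: ltW.
rewrite RintegralZl//.
rewrite (_ : Rintegral _ _ _ = 1) ?mulr1//.
by rewrite /Rintegral integral_exponential_pdf.
Qed.

End exponential_expectation.

(** * Almost sure comparison, Lipschitz bounds for the cosine, random sums *)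

Lemma eq_measure_ae {d} {T : measurableType d} {R : realType}
    (P : probability T R) (A B : set T) :
  measurable A -> measurable B -> {ae P, forall w, A w <-> B w} -> P A = P B.
Proof.
move=> mA mB AB; rewrite -[A]setIT -[B]setIT -!integral_indic//.
apply: ae_eq_integral => //; try exact/measurable_EFinP.
apply: filterS AB => w AB _; rewrite !indicE; congr ((_ : bool)%:R%:E).
by apply/idP/idP; rewrite !inE => /AB.
Qed.

Lemma process_sigma_algebra_preimage {d d'} {T : measurableType d}
    {E : measurableType d'} {I : Type} (D : set I) (X : I -> T -> E) (t : I)
    (A : set E) :
  D t -> measurable A -> process_sigma_algebra D X (X t @^-1` A).
Proof.
move=> Dt mA; apply: sub_sigma_algebra; exists t => //.
by exists A => //; rewrite setTI.
Qed.

Lemma normr_cosB_le {R : realType} (x y : R) : `|cos x - cos y| <= `|x - y|.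
Proof.
wlog xy : x y / y < x.
  move=> H; have [xy|xy|->] := ltgtP x y; [|exact: H|by rewrite !subrr].
  by rewrite distrC [leRHS]distrC H.
have [c _ ->] : exists2 c, c \in `]y, x[ & cos x - cos y = - sin c * (x - y).
  by apply: (MVT xy); apply: continuous_subspaceT; exact: continuous_cos.
by rewrite normrM normrN ler_piMl// sin_max.
Qed.

Lemma normr_cosB_le2 {R : realType} (x y : R) : `|cos x - cos y| <= 2.
Proof. by rewrite (le_trans (ler_normB _ _))// lerD// cos_max. Qed.

Lemma measurable_fun_random_sum {d} {T : measurableType d} {R : realType}
    (P : probability T R) (N : {RV P >-> nat}) (xi : nat -> {RV P >-> R}) :
  measurable_fun setT (fun w => \sum_(k < N w) xi k w).
Proof.
move=> _ B mB; rewrite setTI.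
rewrite (_ : _ @^-1` B = \bigcup_n ((N @^-1` [set n]) `&`
    ((fun w => \sum_(k < n) xi k w) @^-1` B))); last first.
  apply/seteqP; split => [w Bw|w [n _ [<-]]//].
  by exists (N w).
apply: bigcup_measurable => n _; apply: measurableI.
  by rewrite -[_ @^-1` _]setTI; exact: measurable_funPT.
rewrite -[_ @^-1` _]setTI; apply: (measurable_sum _) => //.
Qed.

Lemma Rintegral_dist_le {d} {T : measurableType d} {R : realType}
    (P : probability T R) (f g h : T -> R) :
  P.-integrable setT (EFin \o f) -> P.-integrable setT (EFin \o g) ->
  P.-integrable setT (EFin \o h) ->
  {ae P, forall w, `|f w - g w| <= h w} ->
  `|\int[P]_w f w - \int[P]_w g w| <= \int[P]_w h w.
Proof.
move=> intf intg inth fgh.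
have intfg : P.-integrable setT (EFin \o (fun w => f w - g w)).
  exact: (integrableB _ intf intg).
have intn : P.-integrable setT (EFin \o (fun w => `|f w - g w|)).
  by have /integrable_abse := intfg.
have intnh : P.-integrable setT (EFin \o (fun w => `|h w|)).
  by have /integrable_abse := inth.
rewrite -RintegralB//.
apply: (le_trans (le_normr_Rintegral _ _)) => //.
(* The bound makes [h] nonnegative only almost everywhere; its absolute value has the same integral
   and is nonnegative everywhere, as monotonicity of the integral requires. *)
rewrite (_ : \int[P]_w h w = \int[P]_w `|h w|); last first.
  rewrite /Rintegral; congr fine; apply: ae_eq_integral => //.
  - exact: measurable_int inth.
  - exact: measurable_int intnh.
  - apply: filterS fgh => w fgh _; rewrite ger0_norm//.
    exact: le_trans fgh.
rewrite /Rintegral fine_le//; try exact: integrable_fin_num.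
apply: ae_ge0_le_integral => //.
- exact: measurable_int intn.
- exact: measurable_int intnh.
- apply: filterS fgh => w fgh _; rewrite lee_fin (le_trans fgh)//.
  exact: ler_norm.
Qed.

(** * One compound Poisson increment up to second order in its intensity [b] *)

Section compound_jump.
Context {d : measure_display} {T : measurableType d} {R : realType}.
Variables (P : probability T R) (theta b : R).
Variables (N : {RV P >-> nat}) (Y : {RV P >-> R}) (Z : T -> R).
Hypotheses (theta_gt0 : 0 < theta) (b_gt0 : 0 < b).
Hypothesis Y_exp : forall A : set R, measurable A ->
  distribution P Y A = exponential_prob theta A.
Hypothesis PN0 : P (N @^-1` [set 0%N]) = (expR (- b))%:E.
Hypothesis PN1 : P (N @^-1` [set 1%N]) = (b * expR (- b))%:E.
Hypothesis NY_indep : forall (A : set nat) (B : set R),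
  measurable A -> measurable B ->
  P (N @^-1` A `&` Y @^-1` B) = (P (N @^-1` A) * P (Y @^-1` B))%E.
Hypothesis mZ : measurable_fun setT Z.
Hypothesis Z0 : forall w, N w = 0%N -> Z w = 0.
Hypothesis Z1 : forall w, N w = 1%N -> Z w = Y w.

Let I (k : nat) (w : T) : R := (N w == k)%:R.

Let mI k : measurable_fun setT (I k).
Proof.
by apply: (@measurableT_comp _ _ _ _ _ _ (fun n : nat => (n == k)%:R : R)).
Qed.

Let I_le1 k w : `|I k w| <= 1.
Proof. by rewrite /I; case: eqP; rewrite ?normr1 ?normr0. Qed.

Let intI k : P.-integrable setT (EFin \o I k).
Proof. exact: bounded_integrable (mI k) (I_le1 k). Qed.

Let EI k : \int[P]_w I k w = fine (P (N @^-1` [set k])).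
Proof.
rewrite /Rintegral; congr fine; rewrite -[_ @^-1` _]setIT -integral_indic//.
  apply: eq_integral => w _; rewrite indicE /I; congr ((_ : bool)%:R%:E).
  by apply/eqP/idP => [|]; rewrite inE.
by rewrite -[_ @^-1` _]setTI; exact: measurable_funPT.
Qed.

(** Indicator of two or more jumps, written by subtraction so that its expectation follows from
    [PN0] and [PN1]. *)
Let many (w : T) : R := 1 - I 0%N w - I 1%N w.

Let many01 w : 0 <= many w <= 1.
Proof.
by rewrite /many /I; case: (N w) => [|[|n]] /=; apply/andP; split; lra.
Qed.

Let mmany : measurable_fun setT many.
Proof. by apply: measurable_funB => //; apply: measurable_funB. Qed.

Let many_le1 w : `|many w| <= 1.
Proof. by have /andP[m0 m1] := many01 w; rewrite ger0_norm. Qed.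

Let intmany : P.-integrable setT (EFin \o many).
Proof. exact: bounded_integrable mmany many_le1. Qed.

Let Emany : \int[P]_w many w = 1 - expR (- b) - b * expR (- b).
Proof.
have int1 : P.-integrable setT (EFin \o (fun=> 1 : R)).
  by apply: (@bounded_integrable _ _ _ _ _ 1) => // w; rewrite normr1.
rewrite RintegralB//; last exact: (integrableB _ int1 (intI _)).
rewrite RintegralB// !EI PN0 PN1 /= Rintegral_cst//.
rewrite [X in fine X](_ : _ = 1%E); last exact: probability_setT.
by rewrite /= mulr1.
Qed.

Let Emany_ge0 : 0 <= \int[P]_w many w.
Proof. by apply: Rintegral_ge0 => w _; have /andP[] := many01 w. Qed.

Let expRb : 1 - b <= expR (- b) <= 1.
Proof. by rewrite expR_ge1Dx expR_le1 oppr_le0 ltW. Qed.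

(** The inequality [1 - b <= expR (- b)] bounds the expectation by [1 - (1 + b) * (1 - b)]. *)
Let Emany_le : \int[P]_w many w <= b ^+ 2.
Proof. by rewrite Emany; have /andP[] := expRb; move: b_gt0; nra. Qed.

Let EI1M (f : R -> R) (M : R) :
  measurable_fun setT f -> (forall x, `|f x| <= M) ->
  \int[P]_w (I 1%N w * f (Y w)) = b * expR (- b) * \int[P]_w f (Y w).
Proof.
move=> mf fM.
rewrite (@indep_Rintegral_mul _ _ _ P _ _ _ _ N Y
  (fun n => (n == 1%N)%:R) f 1 M)//; last first.
  by move=> n; case: eqP; rewrite ?normr1 ?normr0.
by rewrite -[\int[P]_w (N w == 1%N)%:R]/(\int[P]_w I 1%N w) EI PN1.
Qed.

(** To first order [Z] is [0] with probability [1 - b] and a single jump [Y] with probability [b].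
    The phases [q = 0] and [q = - pi / 2] give the expansions for the cosine and the sine. *)
Lemma Rintegral_cos_compound_jump (v q : R) :
  `|\int[P]_w cos (v * Z w + q) -
    (cos q + b * ((theta ^+ 2 / (theta ^+ 2 + v ^+ 2) - 1) * cos q -
                  theta * v / (theta ^+ 2 + v ^+ 2) * sin q))| <= 4 * b ^+ 2.
Proof.
set c := _ / _; set s := _ / _.
have mcos : measurable_fun setT (fun x : R => cos (v * x + q)).
  exact: (measurableT_comp measurable_cos (measurable_affine v q)).
have intX (X : T -> R) : measurable_fun setT X ->
    P.-integrable setT (EFin \o (fun w => cos (v * X w + q))).
  move=> mX; apply: (@bounded_integrable _ _ _ _ _ 1).
    exact: (measurableT_comp mcos mX).
  by move=> w; exact: cos_max.
have EY : \int[P]_w cos (v * Y w + q) = c * cos q - s * sin q.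
  have mvY : measurable_fun setT (fun w => v * Y w) by exact: measurable_funM.
  have mcY := measurableT_comp measurable_cos mvY.
  have msY := measurableT_comp measurable_sin mvY.
  have icY : P.-integrable setT (EFin \o (fun w => cos (v * Y w))).
    by apply: (@bounded_integrable _ _ _ _ _ 1) => // w; exact: cos_max.
  have isY : P.-integrable setT (EFin \o (fun w => sin (v * Y w))).
    by apply: (@bounded_integrable _ _ _ _ _ 1) => // w; exact: sin_max.
  under eq_Rintegral do rewrite cosD.
  rewrite RintegralB//; last 2 first.
  - exact: (integrableZr _ _ icY).
  - exact: (integrableZr _ _ isY).
  rewrite RintegralZr// RintegralZr//.
  rewrite (Rintegral_exponential_cos _ _ _ theta_gt0 Y_exp).
  by rewrite (Rintegral_exponential_sin _ _ _ theta_gt0 Y_exp).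
set psi := c * cos q - s * sin q in EY.
have psi_le1 : `|psi| <= 1.
  rewrite -EY; apply: normr_Rintegral_le; last by move=> w; exact: cos_max.
  by apply: (measurableT_comp mcos).
pose approx w := I 0%N w * cos q + I 1%N w * cos (v * Y w + q).
have int0 : P.-integrable setT (EFin \o (fun w => I 0%N w * cos q)).
  exact: (integrableZr _ _ (intI 0%N)).
have int1 : P.-integrable setT (EFin \o (fun w => I 1%N w * cos (v * Y w + q))).
  apply: (@bounded_integrable _ _ _ _ _ 1).
    by apply: measurable_funM => //; apply: (measurableT_comp mcos).
  by move=> w; rewrite normrM mulr_ile1// cos_max.
have Eapprox : \int[P]_w approx w = expR (- b) * cos q + b * expR (- b) * psi.
  rewrite RintegralD// RintegralZr// EI PN0/=.
  by rewrite (EI1M (fun x => cos (v * x + q)) 1)// ?EY// => x; exact: cos_max.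
have dist : `|\int[P]_w cos (v * Z w + q) - \int[P]_w approx w|
    <= \int[P]_w many w.
  apply: Rintegral_dist_le => //; first exact: intX.
    exact: (integrableD _ int0 int1).
  apply: aeW => w; rewrite /approx /many /I.
  have := Z0 w; have := Z1 w.
  case: (N w) => [_ /(_ erefl) ->|[/(_ erefl) -> _|n _ _]] /=.
  - by rewrite mulr0 add0r mul1r mul0r addr0 !subrr normr0 ?subr0.
  - by rewrite mul0r add0r mul1r !subr0 !subrr normr0.
  - by rewrite !mul0r addr0 !subr0 cos_max.
have -> : (c - 1) * cos q - s * sin q = psi - cos q by rewrite /psi; ring.
rewrite Eapprox in dist; move: expRb Emany_le Emany_ge0 Emany dist.
set p2 := \int[P]_w many w; set e := expR (- b).
move=> eb p2_le p2_ge0 p2E dist.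
rewrite (le_trans (ler_distD (e * cos q + b * e * psi) _ _))//.
have -> : 4 * b ^+ 2 = b ^+ 2 + (b ^+ 2 * 2 + b ^+ 2) by ring.
apply: lerD; first exact: le_trans p2_le.
(* Origin of the constant 4: [b ^+ 2] was spent on two or more jumps, [b - b * e <= b ^+ 2] is
   multiplied by [|psi - cos q| <= 2], and the missing mass [p2] costs another [b ^+ 2]. *)
have -> : e * cos q + b * e * psi - (cos q + b * (psi - cos q))
    = (b * e - b) * (psi - cos q) - p2 * cos q by rewrite p2E; ring.
apply: (le_trans (ler_normB _ _)); rewrite !normrM; apply: lerD.
  apply: ler_pM => //.
    by rewrite ler_norml; move: eb b_gt0 => /andP[]; nra.
  by rewrite (le_trans (ler_normB _ _))// lerD// cos_max.
by rewrite ger0_norm// (le_trans _ p2_le)// ler_piMr// cos_max.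
Qed.

(* Two or more jumps have probability at most [b ^+ 2]. *)
Lemma Rintegral_cos_jump_dist (U V : T -> R) (K : R) :
  measurable_fun setT U -> measurable_fun setT V -> 0 <= K ->
  {ae P, forall w, (N w <= 1)%N ->
    `|U w - V w| <= K * ((N w == 1%N)%:R * `|Y w|)} ->
  `|\int[P]_w cos (U w) - \int[P]_w cos (V w)|
    <= 2 * b ^+ 2 + b * (4 * K / theta).
Proof.
move=> mU mV K0 UV.
(* Two cosines never differ by more than 2, so truncating there loses nothing; it makes [g] bounded,
   as the product rule for independent variables requires. *)
pose g (x : R) : R := Num.min 2 (K * `|x|).
have mg : measurable_fun setT g.
  by apply: measurable_minr => //; apply: measurable_funM.
have g_ge0 x : 0 <= g x by rewrite le_min mulr_ge0 ?ler0n.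
have g_le2 x : `|g x| <= 2 by rewrite ger0_norm// ge_min lexx.
have intcos (X : T -> R) : measurable_fun setT X ->
    P.-integrable setT (EFin \o (fun w => cos (X w))).
  move=> mX; apply: (@bounded_integrable _ _ _ _ _ 1).
    exact: (measurableT_comp measurable_cos).
  by move=> w; exact: cos_max.
have int2 : P.-integrable setT (EFin \o (fun w => 2 * many w)).
  exact: (integrableZl _ _ intmany).
have intg : P.-integrable setT (EFin \o (fun w => I 1%N w * g (Y w))).
  apply: (@bounded_integrable _ _ _ _ _ (1 * 2)).
    by apply: measurable_funM => //; apply: measurableT_comp.
  by move=> w; rewrite normrM ler_pM.
apply: (@le_trans _ _ (\int[P]_w (2 * many w + I 1%N w * g (Y w)))).
  apply: Rintegral_dist_le; [exact: intcos|exact: intcos| |].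
    exact: (integrableD _ int2 intg).
  apply: filterS UV => w UV.
  have [N1|N1] := leqP (N w) 1; last first.
    apply: (le_trans (normr_cosB_le2 _ _)).
    have -> : many w = 1.
      rewrite /many /I; move: N1.
      by case: (N w) => [|[|n]]//= _; rewrite !subr0.
    by rewrite mulr1 lerDl mulr_ge0.
  apply: (@le_trans _ _ (I 1%N w * g (Y w))); last first.
    by rewrite lerDr mulr_ge0//; have /andP[] := many01 w.
  have := UV N1; rewrite /I; case: eqP => _ /=; last first.
    rewrite !mul0r mulr0 => UV0.
    by rewrite (le_trans (normr_cosB_le _ _)).
  rewrite !mul1r le_min normr_cosB_le2 /=.
  exact: le_trans (normr_cosB_le _ _).
rewrite RintegralD// RintegralZl// (EI1M g 2)//.
apply: lerD; first by rewrite ler_pM2l.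
apply: ler_pM => //.
- by rewrite mulr_ge0 ?expR_ge0// ltW.
- exact: Rintegral_ge0.
- by apply: ler_piMr; [exact: ltW|have /andP[] := expRb].
- apply: (Rintegral_exponential_le _ _ _ theta_gt0 Y_exp g 2) => // x.
  by rewrite g_ge0/= ge_min lexx orbT.
Qed.

End compound_jump.

(** * One time step of the stationary characteristic function *)

(** The law is prescribed for increments and [N 0] vanishes only almost surely, so the events for
    [N t] and [N t - N 0] agree up to a null set. *)
Lemma poisson_process_marginal {d} {T : measurableType d} {R : realType}
    (P : probability T R) (rate : R) (N : R -> {RV P >-> nat})
    (t : R) (k : nat) :
  poisson_process rate N -> 0 < t ->
  P (N t @^-1` [set k]) = (poisson_pmf (rate * t) k)%:E.
Proof.
move=> [path _ law] t_gt0.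
have mN s (A : set nat) : measurable (N s @^-1` A).
  by rewrite -[_ @^-1` _]setTI; exact: measurable_funPT.
rewrite -[t in RHS]subr0 -(law 0 t k)//.
apply: eq_measure_ae => //.
  rewrite (_ : [set _ | _] = \bigcup_n ((N 0 @^-1` [set n]) `&`
      (N t @^-1` [set m | (m - n)%N = k]))); last first.
    by apply/seteqP; split => [w /= Nw|w [n _ /= [<-]]//]; exists (N 0 w).
  by apply: bigcup_measurable => n _; apply: measurableI.
by apply: filterS path => w [N0 _ _] /=; rewrite N0 subn0.
Qed.

Lemma stationary_Rintegral {d} {T : measurableType d} {R : realType}
    (P : probability T R) (X : R -> {RV P >-> R}) (f : R -> R) (M t : R) :
  stationary X -> 0 <= t -> measurable_fun setT f ->
  (forall x, `|f x| <= M) -> \int[P]_w f (X t w) = \int[P]_w f (X 0 w).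
Proof.
move=> statX t_ge0 mf fM.
have intf s : P.-integrable setT (EFin \o f \o X s).
  apply: (@bounded_integrable _ _ _ _ _ M) => //.
  exact: (measurableT_comp mf).
rewrite /Rintegral; congr fine.
rewrite -(integral_distribution (X := X t) (f := EFin \o f))//; last first.
  exact/measurable_EFinP.
rewrite -(integral_distribution (X := X 0) (f := EFin \o f))//; last first.
  exact/measurable_EFinP.
by apply: eq_measure_integral => A mA _; exact: statX.
Qed.

Section OU_marginal.
Context {R : realType} {d : measure_display} {T : measurableType d}.
Variables (P : probability T R) (lambda alpha theta : R).
Hypotheses (lambda_gt0 : 0 < lambda) (alpha_gt0 : 0 < alpha)
  (theta_gt0 : 0 < theta).
Variables (N : R -> {RV P >-> nat}) (xi : nat -> {RV P >-> R}).
Hypotheses (N_poisson : poisson_process alpha N)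
  (xi_iid : iid_exponential theta xi).
Hypothesis N_xi_indep : indep_classes P
  (process_sigma_algebra [set t : R | 0 <= t] (fun t => N t : T -> nat))
  (process_sigma_algebra [set: nat] (fun k => xi k : T -> R)).
Variable X : R -> {RV P >-> R}.
Hypothesis X_solution : OU_solution lambda (compound_poisson N xi) X.
Hypothesis X_stationary : stationary X.

(** Time [a / lambda] of the solution is time [a] of the driving process. If [N a <= 1],
    monotonicity of [N] leaves the driving path on [[0, a]] only the values [0] and [xi 0], the
    latter only if [N a = 1]; this gives the bound [M] in the pathwise estimate. *)
Lemma OU_increment_ae (a : R) : 0 < a <= 2^-1 ->
  {ae P, forall w, (N a w <= 1)%N ->
    `|X (a / lambda) w - expR (- a) * X 0 w - compound_poisson N xi a w|
      <= 2 * a * ((N a w == 1%N)%:R * `|xi 0%N w|)}.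
Proof.
move=> /andP[a_gt0 a_le].
have lambdaK : lambda * (a / lambda) = a by field; rewrite gt_eqF.
have [path _ _] := N_poisson; have [OU _] := X_solution.
apply: filterS2 path OU => w [N0 Nmono _] OU Na.
have := @OU_path_increment R lambda (a / lambda)
  ((N a w == 1%N)%:R * `|xi 0%N w|)
  (compound_poisson N xi ^~ w) (X ^~ w) lambda_gt0.
rewrite lambdaK; apply => //.
- by rewrite divr_ge0// ltW.
- by rewrite /compound_poisson N0 big_ord0.
- move=> s /andP[s_ge0 sa]; have := Nmono s a s_ge0 sa.
  rewrite /compound_poisson; move: Na.
  case: (N a w) => [|[|//]] _; case: (N s w) => [|[|//]] //= _.
  + by rewrite big_ord0 normr0 mul0r.
  + by rewrite big_ord0 normr0 mul1r.
  + by rewrite big_ord1 mul1r.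
Qed.

Let A (v p : R) := \int[P]_w cos (v * X 0 w + p).
Let S (v p : R) := \int[P]_w sin (v * X 0 w + p).

Lemma OU_charfun_step (v p a : R) : 0 < a <= 2^-1 ->
  `|A v p - (A (expR (- a) * v) p *
              (1 + alpha * a * (theta ^+ 2 / (theta ^+ 2 + v ^+ 2) - 1)) -
            S (expR (- a) * v) p *
              (alpha * a * (theta * v / (theta ^+ 2 + v ^+ 2))))|
    <= (10 * alpha ^+ 2 + 8 * alpha * `|v| / theta) * a ^+ 2.
Proof.
move=> a_bd; have /andP[a_gt0 a_le] := a_bd.
set v' := expR (- a) * v; set c := theta ^+ 2 / _; set s := theta * v / _.
pose b := alpha * a.
have b_gt0 : 0 < b by rewrite mulr_gt0.
pose Z := compound_poisson N xi a.
have mZ : measurable_fun setT Z by exact: measurable_fun_random_sum.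
have PN k : P (N a @^-1` [set k]) = (b ^+ k * k`!%:R^-1 * expR (- b))%:E.
  by rewrite (@poisson_process_marginal _ _ _ P alpha N)// /poisson_pmf b_gt0.
have PN0 : P (N a @^-1` [set 0%N]) = (expR (- b))%:E.
  by rewrite PN expr0 fact0 invr1 !mul1r.
have PN1 : P (N a @^-1` [set 1%N]) = (b * expR (- b))%:E.
  by rewrite PN expr1 invr1 mulr1.
have Y_exp B : measurable B ->
    distribution P (xi 0%N) B = exponential_prob theta B.
  by have [_ +] := xi_iid; exact.
have NY (B : set nat) (C : set R) : measurable B -> measurable C ->
    P (N a @^-1` B `&` xi 0%N @^-1` C)
    = (P (N a @^-1` B) * P (xi 0%N @^-1` C))%E.
  move=> mB mC; apply: N_xi_indep.
    apply: (process_sigma_algebra_preimage _ (fun t => N t : T -> nat)) => //=.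
    exact: ltW.
  exact: (process_sigma_algebra_preimage _ (fun k => xi k : T -> R)).
have Z0 w : N a w = 0%N -> Z w = 0.
  by rewrite /Z /compound_poisson => ->; rewrite big_ord0.
have Z1 w : N a w = 1%N -> Z w = xi 0%N w.
  by rewrite /Z /compound_poisson => ->; rewrite big_ord1.
have XZ (B C : set R) : measurable B -> measurable C ->
    P (X 0 @^-1` B `&` Z @^-1` C) = (P (X 0 @^-1` B) * P (Z @^-1` C))%E.
  move=> mB mC; have [_ init] := X_solution; apply: init.
    by exists B => //; rewrite setTI.
  by apply: process_sigma_algebra_preimage => //=; exact: ltW.
have maff (f : R -> R) q (W : T -> R) :
    measurable_fun setT f -> measurable_fun setT W ->
    measurable_fun setT (fun w => f (q * W w + p)).
  move=> mf mW.
  exact: (measurableT_comp mf (measurableT_comp (measurable_affine q p) mW)).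
have mlin (f : R -> R) q : measurable_fun setT f ->
    measurable_fun setT (fun x : R => f (q * x)).
  move=> mf; have mq : measurable_fun setT (fun x : R => q * x).
    exact: measurable_funM.
  exact: (measurableT_comp mf mq).
have maffR (f : R -> R) q : measurable_fun setT f ->
    measurable_fun setT (fun x : R => f (q * x + p)).
  by move=> mf; exact: (measurableT_comp mf (measurable_affine q p)).
have step1 : `|\int[P]_w cos (v * X (a / lambda) w + p) -
    \int[P]_w cos (v' * X 0 w + p + v * Z w)|
    <= 2 * b ^+ 2 + b * (4 * (2 * a * `|v|) / theta).
  apply: (Rintegral_cos_jump_dist _ _ _ _ (xi 0%N) theta_gt0 b_gt0 Y_exp
    PN0 PN1 NY) => //.
  - exact: (measurableT_comp (measurable_affine v p)).
  - apply: measurable_funD; last exact: measurable_funM.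
    exact: (measurableT_comp (measurable_affine v' p)).
  - by rewrite !mulr_ge0// ltW.
  - apply: filterS (OU_increment_ae a a_bd) => w UV /UV {}UV.
    have -> : v * X (a / lambda) w + p - (v' * X 0 w + p + v * Z w)
      = v * (X (a / lambda) w - expR (- a) * X 0 w - Z w) by rewrite /v'; ring.
    rewrite normrM [leRHS](_ : _ = `|v| *
      (2 * a * ((N a w == 1%N)%:R * `|xi 0%N w|))); last by ring.
    exact: ler_wpM2l UV.
have -> : A v p = \int[P]_w cos (v * X (a / lambda) w + p).
  rewrite /A.
  rewrite (stationary_Rintegral _ _
    (fun x => cos (v * x + p)) 1 (a / lambda))//.
  - by rewrite divr_ge0// ltW.
  - exact: maffR measurable_cos.
  - by move=> x; exact: cos_max.
(* Real part of the product of two characteristic functions, that of [X 0] (with phase [p]) and that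
   of [Z], which are independent. *)
have step2 : \int[P]_w cos (v' * X 0 w + p + v * Z w) =
    A v' p * \int[P]_w cos (v * Z w) - S v' p * \int[P]_w sin (v * Z w).
  under eq_Rintegral do rewrite cosD.
  rewrite RintegralB//.
  - rewrite (@indep_Rintegral_mul _ _ _ P _ _ _ _ (X 0) Z
      (fun x => cos (v' * x + p)) (fun y => cos (v * y)) 1 1)//.
    + rewrite (@indep_Rintegral_mul _ _ _ P _ _ _ _ (X 0) Z
        (fun x => sin (v' * x + p)) (fun y => sin (v * y)) 1 1)//.
      * exact: maffR measurable_sin.
      * exact: mlin measurable_sin.
      * by move=> x; exact: sin_max.
      * by move=> x; exact: sin_max.
    + exact: maffR measurable_cos.
    + exact: mlin measurable_cos.
    + by move=> x; exact: cos_max.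
    + by move=> x; exact: cos_max.
  - apply: (@bounded_integrable _ _ _ _ _ 1).
      apply: measurable_funM; first exact: maff measurable_cos _.
      exact: (measurableT_comp (mlin _ _ measurable_cos)).
    by move=> w; rewrite normrM mulr_ile1// cos_max.
  - apply: (@bounded_integrable _ _ _ _ _ 1).
      apply: measurable_funM; first exact: maff measurable_sin _.
      exact: (measurableT_comp (mlin _ _ measurable_sin)).
    by move=> w; rewrite normrM mulr_ile1// sin_max.
have jump q := @Rintegral_cos_compound_jump _ _ _ P theta b (N a) (xi 0%N) Z
  theta_gt0 b_gt0 Y_exp PN0 PN1 NY mZ Z0 Z1 v q.
have jumpC : `|\int[P]_w cos (v * Z w) - (1 + b * (c - 1))| <= 4 * b ^+ 2.
  have := jump 0; under eq_Rintegral do rewrite addr0.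
  by rewrite cos0 sin0 mulr1 mulr0 subr0.
have jumpS : `|\int[P]_w sin (v * Z w) - b * s| <= 4 * b ^+ 2.
  have := jump (- (pi / 2)).
  under eq_Rintegral do
    rewrite cosD cosN sinN cos_pihalf sin_pihalf mulr0 mulrN1 opprK add0r.
  by rewrite cosN sinN cos_pihalf sin_pihalf mulr0 mulrN1 opprK !add0r.
move: step1; rewrite step2.
set EC := \int[P]_w cos (v * Z w) in jumpC *.
set ES := \int[P]_w sin (v * Z w) in jumpS *.
have A1 : `|A v' p| <= 1.
  apply: normr_Rintegral_le; last by move=> w; exact: cos_max.
  exact: maff measurable_cos _.
have S1 : `|S v' p| <= 1.
  apply: normr_Rintegral_le; last by move=> w; exact: sin_max.
  exact: maff measurable_sin _.
move=> step1; apply: (le_trans (ler_distD (A v' p * EC - S v' p * ES) _ _)).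
(* The first summand is the cost of linearizing the OU step; the other two come from expanding [EC]
   and [ES], whose coefficients [A v' p] and [S v' p] are at most 1 in absolute value. *)
have -> : (10 * alpha ^+ 2 + 8 * alpha * `|v| / theta) * a ^+ 2 =
    (2 * b ^+ 2 + b * (4 * (2 * a * `|v|) / theta)) +
    (4 * b ^+ 2 + 4 * b ^+ 2) by rewrite /b; field; rewrite gt_eqF.
apply: lerD => //.
have -> : A v' p * EC - S v' p * ES -
    (A v' p * (1 + alpha * a * (c - 1)) - S v' p * (alpha * a * s)) =
    A v' p * (EC - (1 + b * (c - 1))) - S v' p * (ES - b * s).
  by rewrite /b; ring.
rewrite (le_trans (ler_normB _ _))// !normrM.
by apply: lerD; rewrite -[leRHS]mul1r; apply: ler_pM.
Qed.

End OU_marginal.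

(** * From the step estimate to a derivative *)

(* The increment of [f] over an interval is controlled by the right endpoint of
   the coefficients and the left endpoint of the unknowns, hence the [max] and
   [min] which treat both one-sided derivatives at once. *)
Lemma is_derive_implicit_step {R : realType} (f g k l : R -> R) (t C : R) :
  {for t, continuous f} -> {for t, continuous g} ->
  {for t, continuous k} -> {for t, continuous l} ->
  (forall r a, `|r - t| <= 1 -> 0 < a <= 2^-1 ->
    `|f r - (f (r - a) * (1 + a * k r) - g (r - a) * (a * l r))|
      <= C * a ^+ 2) ->
  is_derive t (1 : R) f (k t * f t - l t * g t).
Proof.
move=> cf cg ck cl step.
(* These are the larger and the smaller of [t] and [t + h], in a form whose continuity in [h] is
   immediate. For [h > 0] the estimate is applied at [r = h + t] with [a = h], for [h < 0] at
   [r = t] with [a = - h]. *)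
pose up h := t + (h + `|h|) / 2; pose dn h := t + (h - `|h|) / 2.
pose Phi h := k (up h) * f (dn h) - l (up h) * g (dn h).
have cup : up h @[h --> (0 : R)] --> t.
  have E : t + (0 + `|0 : R|) / 2 = t by rewrite normr0 addr0 mul0r addr0.
  rewrite -[X in _ --> X]E.
  apply: cvgD; first exact: cvg_cst.
  apply: cvgM; last exact: cvg_cst.
  by apply: cvgD; [exact: cvg_id|apply: cvg_norm; exact: cvg_id].
have cdn : dn h @[h --> (0 : R)] --> t.
  have E : t + (0 - `|0 : R|) / 2 = t by rewrite normr0 subr0 mul0r addr0.
  rewrite -[X in _ --> X]E.
  apply: cvgD; first exact: cvg_cst.
  apply: cvgM; last exact: cvg_cst.
  by apply: cvgB; [exact: cvg_id|apply: cvg_norm; exact: cvg_id].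
have cPhi : Phi h @[h --> (0 : R)] --> k t * f t - l t * g t.
  apply: cvgB; apply: cvgM.
  - exact: (cvg_comp _ _ cup ck).
  - exact: (cvg_comp _ _ cdn cf).
  - exact: (cvg_comp _ _ cup cl).
  - exact: (cvg_comp _ _ cdn cg).
have slope h : h != 0 -> `|h| <= 2^-1 ->
    `|h^-1 * (f (h + t) - f t) - Phi h| <= C * `|h|.
  move=> h0 hle; have [h_gt0|h_lt0|/eqP] := ltgtP 0 h; last 1 first.
    by rewrite eq_sym (negbTE h0).
  - rewrite gtr0_norm// in hle *.
    have htK : h + t - h = t by ring.
    have := step (h + t) h; rewrite htK addrK gtr0_norm// h_gt0 hle.
    have h1 : h <= 1 by lra.
    move=> /(_ h1 isT) st.
    have upE : up h = h + t by rewrite /up gtr0_norm//; field.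
    have dnE : dn h = t by rewrite /dn gtr0_norm//; field.
    rewrite /Phi upE dnE -(ler_pM2l h_gt0) -[X in X * `|_|]gtr0_norm// -normrM.
    rewrite [leRHS](_ : _ = C * h ^+ 2); last by ring.
    apply: le_trans st; rewrite le_eqVlt; apply/orP; left; apply/eqP.
    by congr `|_|; field.
  - rewrite ltr0_norm// in hle *.
    have nh_gt0 : 0 < - h by rewrite oppr_gt0.
    have := step t (- h); rewrite subrr normr0 ler01 opprK nh_gt0 hle.
    move=> /(_ isT isT) st.
    have upE : up h = t by rewrite /up ltr0_norm//; field.
    have dnE : dn h = t + h by rewrite /dn ltr0_norm//; field.
    rewrite /Phi upE dnE -(ler_pM2l nh_gt0) -[X in X * `|_|]gtr0_norm// -normrM.
    rewrite [leRHS](_ : _ = C * (- h) ^+ 2); last by ring.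
    apply: le_trans st; rewrite le_eqVlt; apply/orP; left; apply/eqP.
    by rewrite [h + t]addrC; congr `|_|; field.
have lim : h^-1 *: (f (h *: (1 : R) + t) - f t) @[h --> (0 : R)^'] -->
    k t * f t - l t * g t.
  have cPhi' : Phi h @[h --> (0 : R)^'] --> k t * f t - l t * g t.
    exact: cvg_within_filter cPhi.
  rewrite -[X in _ --> X]addr0.
  rewrite (_ : (fun h => _) = (fun h => Phi h +
      (h^-1 *: (f (h *: (1 : R) + t) - f t) - Phi h))); last first.
    by apply/funext => h; rewrite [RHS]addrC subrK.
  apply: cvgD => //; apply/norm_cvg0P.
  apply: (@squeeze_cvgr _ _ _ _ (cst 0) (fun h => C * `|h|)).
  - have h_neq0 : \forall h \near (0 : R)^', h != 0 by exact: nbhs_dnbhs_neq.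
    have h_le : \forall h \near (0 : R)^', `|h| <= 2^-1.
      by apply: dnbhs0_le; rewrite invr_gt0.
    apply: filterS2 h_neq0 h_le => h h0 hle.
    by rewrite normr_ge0/= /GRing.scale/= mulr1; exact: slope.
  - exact: cvg_cst.
  - rewrite -[X in _ --> X](mulr0 C) -[X in _ --> C * X](normr0 R).
    apply: cvgM; first exact: cvg_cst.
    by apply: cvg_within_filter; apply: cvg_norm; exact: cvg_id.
apply: DeriveDef.
  by apply/cvg_ex; eexists; exact: lim.
exact: cvg_lim lim.
Qed.

Lemma continuous_Rintegral_cos {d} {T : measurableType d} {R : realType}
    (P : probability T R) (X : {RV P >-> R}) (p : R) :
  continuous (fun v : R => \int[P]_w cos (v * X w + p)).
Proof.
move=> v.
have mX r : measurable_fun setT (fun w => cos (r * X w + p)).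
  apply: (measurableT_comp measurable_cos).
  exact: (measurableT_comp (measurable_affine r p)).
have v_in : v \in `](v - 1), (v + 1)[%classic.
  by rewrite inE/= in_itv/= ltrDl ltr01 gtrBl ltr01.
apply: (@continuity_under_integral R _ _ P (fun r w => cos (r * X w + p)) setT
  measurableT (v - 1) (v + 1) _ _ (fun=> 1)) => //.
- move=> r _; apply: (@bounded_integrable _ _ _ _ _ 1) => // w; exact: cos_max.
- apply: aeW => w _ r _; apply: continuous_comp; last exact: continuous_cos.
  by apply: cvgD; [apply: cvgM; [exact: cvg_id|exact: cvg_cst]|exact: cvg_cst].
- by apply: (@bounded_integrable _ _ _ _ _ 1) => // w; rewrite normr1.
- by move=> r _; apply: aeW => w _; exact: cos_max.
Qed.

Lemma Rintegral_sinE {d} {T : measurableType d} {R : realType}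
    (P : probability T R) (X : {RV P >-> R}) (v p : R) :
  \int[P]_w sin (v * X w + p) = \int[P]_w cos (v * X w + (p - pi / 2)).
Proof. by apply: eq_Rintegral => w _; rewrite addrA cosBpihalf. Qed.

Lemma continuous_Rintegral_sin {d} {T : measurableType d} {R : realType}
    (P : probability T R) (X : {RV P >-> R}) (p : R) :
  continuous (fun v : R => \int[P]_w sin (v * X w + p)).
Proof.
rewrite (_ : (fun _ => _) = fun v => \int[P]_w cos (v * X w + (p - pi / 2))).
  exact: continuous_Rintegral_cos.
by apply/funext => v; exact: Rintegral_sinE.
Qed.

(** * Solving the equation, and the principal branch of the power *)

(** The function [H] of the proof is the real part of [(F x + i G x) (1 - i x w)^alpha], that is, of
    the solution times its integrating factor. It is constant along [x = expR t]; the point [x = 0]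
    is reached only in the limit, by continuity of [F] and [G] there, and at [0] the sine kills the
    term in [G]. *)
Lemma rotation_ode_solution {R : realType} (alpha w : R) (F G : R -> R) :
  (forall t, is_derive t (1 : R) (fun t => F (expR t))
    (- (alpha * ((expR t * w) ^+ 2 / (1 + (expR t * w) ^+ 2))) * F (expR t)
     - alpha * (expR t * w / (1 + (expR t * w) ^+ 2)) * G (expR t))) ->
  (forall t, is_derive t (1 : R) (fun t => G (expR t))
    (- (alpha * ((expR t * w) ^+ 2 / (1 + (expR t * w) ^+ 2))) * G (expR t)
     + alpha * (expR t * w / (1 + (expR t * w) ^+ 2)) * F (expR t))) ->
  {for 0, continuous F} -> {for 0, continuous G} ->
  expR (alpha / 2 * ln (1 + w ^+ 2)) *
    (F 1 * cos (alpha * atan w) + G 1 * sin (alpha * atan w)) = F 0.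
Proof.
move=> dF dG cF cG.
pose H x := expR (alpha / 2 * ln (1 + (x * w) ^+ 2)) *
    (F x * cos (alpha * atan (x * w)) + G x * sin (alpha * atan (x * w))).
have q_gt0 x : 0 < 1 + (x * w) ^+ 2 by rewrite ltr_pwDl ?sqr_ge0.
have dH t : is_derive t (1 : R) (fun t => H (expR t)) 0.
  have dm : is_derive t (1 : R) (fun t => expR t * w) (expR t * w).
    by apply: is_derive_eq; rewrite /GRing.scale/=; ring.
  have dq : is_derive t (1 : R) (fun t => 1 + (expR t * w) ^+ 2)
      (2 * (expR t * w) ^+ 2).
    by apply: is_derive_eq; rewrite /GRing.scale/=; ring.
  have dln : is_derive t (1 : R) (fun t => ln (1 + (expR t * w) ^+ 2))
      ((1 + (expR t * w) ^+ 2)^-1 * (2 * (expR t * w) ^+ 2)).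
    exact: (@is_derive1_comp R (@ln R) _ t _ _
      (is_derive1_ln (q_gt0 (expR t))) dq).
  have dat : is_derive t (1 : R) (fun t => atan (expR t * w))
      ((1 + (expR t * w) ^+ 2)^-1 * (expR t * w)).
    exact: (@is_derive1_comp R (@atan R) _ t _ _
      (is_derive1_atan (expR t * w)) dm).
  have := dF t; have := dG t => dGt dFt.
  rewrite /H; apply: is_derive_eq; rewrite /GRing.scale/=.
  have q0 : 1 + (expR t * w) ^+ 2 != 0 by rewrite gt_eqF.
  set y := expR t * w in q0 *.
  set ct := cos _; set st := sin _; set r := expR (_ * _).
  field.
  by move: q0; rewrite expr2.
have HcF : H (expR (- x)) @[x --> +oo] --> H 0.
  have cm : continuous (fun x : R => x * w).
    by move=> x; apply: cvgM; [exact: cvg_id|exact: cvg_cst].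
  have cat : continuous (fun x : R => alpha * atan (x * w)).
    move=> x; apply: cvgM; first exact: cvg_cst.
    by apply: continuous_comp; [exact: cm|exact: continuous_atan].
  have cln : continuous (fun x : R => alpha / 2 * ln (1 + (x * w) ^+ 2)).
    move=> x; apply: cvgM; first exact: cvg_cst.
    apply: continuous_comp; last exact: continuous_ln.
    by apply: cvgD; [exact: cvg_cst|apply: cvgM; exact: cm].
  apply: (@cvg_comp _ _ _ _ H _ (nbhs (0 : R))); first exact: cvgr_expR.
  have cH : {for (0 : R), continuous H}.
    apply: cvgM.
      by apply: continuous_comp; [exact: cln|exact: continuous_expR].
    apply: cvgD; apply: cvgM.
    - exact: cF.
    - by apply: continuous_comp; [exact: cat|exact: continuous_cos].
    - exact: cG.
    - by apply: continuous_comp; [exact: cat|exact: continuous_sin].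
  exact: cH.
have Hcst x : H (expR (- x)) = H 1.
  rewrite -[1 in RHS]expR0.
  exact: (@is_derive_0_is_cst R (fun t => H (expR t)) (- x) 0 dH).
have H10 : H 1 = H 0.
  rewrite (_ : (fun x => H (expR (- x))) = cst (H 1)) in HcF; last exact/funext.
  exact: (cvg_unique _ (cvg_cst (H 1)) HcF).
have := H10; rewrite /H !mul1r mul0r expr0n/= addr0 ln1 mulr0 expR0 mul1r.
by rewrite atan0 mulr0 cos0 sin0 mulr1 mulr0 addr0.
Qed.

(** The real part over the modulus is [cos (atan y)]. The sign test in [carg] matches that of
    [atan y], which selects the right inverse branch of the cosine. *)
Lemma carg_1subi {R : realType} (y : R) : carg (Complex 1 (- y)) = - atan y.
Proof.
rewrite /carg /ComplexField.Normc.normc /= sqrrN expr1n div1r -cos_atan.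
have pi2_gt0 : 0 < pi / 2 :> R by rewrite divr_gt0// pi_gt0.
have := atan_ltpi2 y; have := atan_gtNpi2 y => Hl Hr.
rewrite oppr_ge0; case: leP => [y0|y0].
  rewrite cosKN//.
  have a0 : atan y <= 0 by rewrite -atan0; exact: le_atan.
  by rewrite a0 andbT; lra.
congr (- _); rewrite cosK// in_itv/=.
have a0 : 0 <= atan y by rewrite -atan0; apply: le_atan; exact: ltW.
by rewrite a0/=; lra.
Qed.

Lemma cpowR_1subi {R : realType} (alpha y : R) :
  cpowR (Complex 1 (- y)) (- alpha) =
  Complex ((expR (alpha / 2 * ln (1 + y ^+ 2)))^-1 * cos (alpha * atan y))
          ((expR (alpha / 2 * ln (1 + y ^+ 2)))^-1 * sin (alpha * atan y)).
Proof.
have q_gt0 : 0 < 1 + y ^+ 2 by rewrite ltr_pwDl ?sqr_ge0.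
rewrite /cpowR carg_1subi mulrNN /ComplexField.Normc.normc /= sqrrN expr1n.
rewrite -powR12_sqrt ?(ltW q_gt0)// -powRrM /powR gt_eqF// -expRN.
by congr (Complex (expR _ * _) (expR _ * _)); field.
Qed.

(** * Identification of the stationary characteristic function *)

Section OU_stationary_charfun.
Context {R : realType} {d : measure_display} {T : measurableType d}.
Variables (P : probability T R) (lambda alpha theta : R).
Hypotheses (lambda_gt0 : 0 < lambda) (alpha_gt0 : 0 < alpha)
  (theta_gt0 : 0 < theta).
Variables (N : R -> {RV P >-> nat}) (xi : nat -> {RV P >-> R}).
Hypotheses (N_poisson : poisson_process alpha N)
  (xi_iid : iid_exponential theta xi).
Hypothesis N_xi_indep : indep_classes P
  (process_sigma_algebra [set t : R | 0 <= t] (fun t => N t : T -> nat))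
  (process_sigma_algebra [set: nat] (fun k => xi k : T -> R)).
Variable X : R -> {RV P >-> R}.
Hypothesis X_solution : OU_solution lambda (compound_poisson N xi) X.
Hypothesis X_stationary : stationary X.

Let A (v p : R) := \int[P]_w cos (v * X 0 w + p).
Let S (v p : R) := \int[P]_w sin (v * X 0 w + p).

Lemma is_derive_OU_charfun (u p t : R) :
  is_derive t (1 : R) (fun t => A (expR t * u) p)
    (alpha * (theta ^+ 2 / (theta ^+ 2 + (expR t * u) ^+ 2) - 1)
       * A (expR t * u) p
     - alpha * (theta * (expR t * u) / (theta ^+ 2 + (expR t * u) ^+ 2))
       * S (expR t * u) p).
Proof.
have cv : continuous (fun t : R => expR t * u).
  by move=> x; apply: cvgM; [exact: continuous_expR|exact: cvg_cst].
have D0 (x : R) : theta ^+ 2 + (expR x * u) ^+ 2 != 0.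
  by rewrite gt_eqF// ltr_pwDl ?sqr_ge0// exprn_gt0.
have cDV : continuous (fun x : R => (theta ^+ 2 + (expR x * u) ^+ 2)^-1).
  move=> x; apply: cvgV; first exact: D0.
  by apply: cvgD; [exact: cvg_cst|apply: cvgM; exact: cv].
(* The step constant grows with [|v| = expR r * |u|]; for [r] within distance 1 of [t] it is at most
   this [C]. *)
pose C := 10 * alpha ^+ 2 + 8 * alpha * (expR (t + 1) * `|u|) / theta.
apply: (@is_derive_implicit_step R (fun t => A (expR t * u) p)
  (fun t => S (expR t * u) p)
  (fun t => alpha * (theta ^+ 2 / (theta ^+ 2 + (expR t * u) ^+ 2) - 1))
  (fun t => alpha * (theta * (expR t * u) / (theta ^+ 2 + (expR t * u) ^+ 2)))
  t C).
- apply: (@continuous_comp R R R (fun t => expR t * u) (fun v => A v p) t).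
    exact: cv.
  exact: continuous_Rintegral_cos.
- apply: (@continuous_comp R R R (fun t => expR t * u) (fun v => S v p) t).
    exact: cv.
  exact: continuous_Rintegral_sin.
- apply: cvgM; first exact: cvg_cst.
  apply: cvgB; last exact: cvg_cst.
  by apply: cvgM; [exact: cvg_cst|exact: cDV].
- apply: cvgM; first exact: cvg_cst.
  apply: cvgM; last exact: cDV.
  by apply: cvgM; [exact: cvg_cst|exact: cv].
- move=> r a r_le a_bd.
  have := OU_charfun_step P lambda alpha theta lambda_gt0 alpha_gt0 theta_gt0
    N xi N_poisson xi_iid N_xi_indep X X_solution X_stationary
    (expR r * u) p a a_bd.
  rewrite (_ : expR (- a) * (expR r * u) = expR (r - a) * u); last first.
    by rewrite mulrA -expRD addrC.
  rewrite -/(A _ _) -/(A _ _) -/(S _ _) => step.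
  rewrite [X in `|X|](_ : _ = A (expR r * u) p -
     (A (expR (r - a) * u) p *
      (1 + alpha * a * (theta ^+ 2 / (theta ^+ 2 + (expR r * u) ^+ 2) - 1)) -
      S (expR (r - a) * u) p *
      (alpha * a * (theta * (expR r * u) / (theta ^+ 2 + (expR r * u) ^+ 2)))));
    last by ring.
  apply: (le_trans step); rewrite ler_wpM2r ?sqr_ge0// lerD2l.
  rewrite ler_wpM2r ?invr_ge0 ?(ltW theta_gt0)// ler_wpM2l//.
    by rewrite mulr_ge0// ltW.
  rewrite normrM ger0_norm ?expR_ge0// ler_wpM2r// ler_expR.
  by rewrite -lerBlDl (le_trans (ler_norm _)).
Qed.

Lemma OU_charfun_solution (u : R) :
  let y := theta^-1 * u in
  let r := (expR (alpha / 2 * ln (1 + y ^+ 2)))^-1 in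
  A u 0 = r * cos (alpha * atan y) /\ S u 0 = r * sin (alpha * atan y).
Proof.
move=> y r.
have q0 t : 1 + (expR t * y) ^+ 2 != 0.
  by rewrite gt_eqF// ltr_pwDl ?sqr_ge0.
have th0 : theta != 0 by rewrite gt_eqF.
have D0 (t : R) : theta ^+ 2 + (expR t * u) ^+ 2 != 0.
  by rewrite gt_eqF// ltr_pwDl ?sqr_ge0// exprn_gt0.
have kE (t : R) : alpha * (theta ^+ 2 / (theta ^+ 2 + (expR t * u) ^+ 2) - 1)
    = - (alpha * ((expR t * y) ^+ 2 / (1 + (expR t * y) ^+ 2))).
  by rewrite /y; field; rewrite th0 D0.
have lE (t : R) :
    alpha * (theta * (expR t * u) / (theta ^+ 2 + (expR t * u) ^+ 2))
    = alpha * (expR t * y / (1 + (expR t * y) ^+ 2)).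
  by rewrite /y; field; rewrite th0 D0.
pose F x := A (x * u) 0; pose G x := S (x * u) 0.
have SE v p : S v p = A v (p - pi / 2) by exact: Rintegral_sinE.
(* Lowering the phase by [pi / 2] sends [(A, S)] to [(S, - A)], so the equation for [G] is the one
   for [A] at phase [- pi / 2]. *)
have S2 v : S v (0 - pi / 2) = - A v 0.
  rewrite -[RHS]mulN1r /S /A -RintegralZl//; last first.
    apply: (@bounded_integrable _ _ _ _ _ 1) => [|w]; last exact: cos_max.
    apply: (measurableT_comp measurable_cos).
    exact: (measurableT_comp (measurable_affine v 0)).
  by apply: eq_Rintegral => w _; rewrite addrA sinBpihalf mulN1r.
have dF t : is_derive t (1 : R) (fun t => F (expR t))
    (- (alpha * ((expR t * y) ^+ 2 / (1 + (expR t * y) ^+ 2))) * F (expR t)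
     - alpha * (expR t * y / (1 + (expR t * y) ^+ 2)) * G (expR t)).
  by rewrite -kE -lE; exact: is_derive_OU_charfun.
have dG t : is_derive t (1 : R) (fun t => G (expR t))
    (- (alpha * ((expR t * y) ^+ 2 / (1 + (expR t * y) ^+ 2))) * G (expR t)
     + alpha * (expR t * y / (1 + (expR t * y) ^+ 2)) * F (expR t)).
  rewrite -kE -lE /G /F.
  rewrite (_ : (fun t => S (expR t * u) 0) =
    (fun t => A (expR t * u) (0 - pi / 2))); last first.
    by apply/funext => x; rewrite SE.
  rewrite SE -[A _ 0]opprK -S2 mulrN.
  exact: is_derive_OU_charfun.
have cu : continuous (fun x : R => x * u).
  by move=> x; apply: cvgM; [exact: cvg_id|exact: cvg_cst].
have cF : {for (0 : R), continuous F}.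
  apply: (@continuous_comp R R R (fun x => x * u) (fun v => A v 0) 0).
    exact: cu.
  exact: continuous_Rintegral_cos.
have cG : {for (0 : R), continuous G}.
  apply: (@continuous_comp R R R (fun x => x * u) (fun v => S v 0) 0).
    exact: cu.
  exact: continuous_Rintegral_sin.
have F0 : F 0 = 1.
  rewrite /F /A; under eq_Rintegral do rewrite !mul0r addr0 cos0.
  rewrite Rintegral_cst// [X in fine X](_ : _ = 1%E) ?mulr1//.
  exact: probability_setT.
have G0 : G 0 = 0.
  rewrite /G /S; under eq_Rintegral do rewrite !mul0r addr0 sin0.
  by rewrite Rintegral_cst// mul0r.
have := rotation_ode_solution alpha y F G dF dG cF cG.
have dNF t : is_derive t (1 : R) (fun t => - F (expR t))
    (- (alpha * ((expR t * y) ^+ 2 / (1 + (expR t * y) ^+ 2))) * - F (expR t)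
     + alpha * (expR t * y / (1 + (expR t * y) ^+ 2)) * G (expR t)).
  by apply: is_derive_eq; ring.
have dG' t : is_derive t (1 : R) (fun t => G (expR t))
    (- (alpha * ((expR t * y) ^+ 2 / (1 + (expR t * y) ^+ 2))) * G (expR t)
     - alpha * (expR t * y / (1 + (expR t * y) ^+ 2)) * - F (expR t)).
  by apply: is_derive_eq; ring.
have cNF : {for (0 : R), continuous (fun x => - F x)} by apply: cvgN; exact: cF.
(* The pair [(G, - F)] represents [- i (F + i G)] and solves the same system; its real part is the
   imaginary part of the conserved product, with limit [G 0 = 0]. *)
have := rotation_ode_solution alpha y G (fun x => - F x) dG' dNF cG cNF.
rewrite F0 G0 /F /G !mul1r.
set c := cos _; set s := sin _ => E2 E1.
have r0 : r != 0 by rewrite invr_eq0 gt_eqF ?expR_gt0.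
have cs : c ^+ 2 + s ^+ 2 = 1 by exact: cos2Dsin2.
have E1' : A u 0 * c + S u 0 * s = r.
  by rewrite -[RHS]mulr1 -E1 mulrA mulVf ?mul1r// gt_eqF ?expR_gt0.
have E2' : S u 0 * c + - A u 0 * s = 0.
  by apply/eqP; move/eqP : E2; rewrite mulf_eq0 gt_eqF ?expR_gt0.
(* [E1'] and [E2'] give the rotation of [(A u 0, S u 0)] by the angle [- alpha * atan y]; the
   inverse rotation recovers both coordinates. *)
split.
- transitivity (A u 0 * (c ^+ 2 + s ^+ 2)); first by rewrite cs mulr1.
  transitivity ((A u 0 * c + S u 0 * s) * c - (S u 0 * c + - A u 0 * s) * s).
    by ring.
  by rewrite E1' E2' mul0r subr0.
- transitivity (S u 0 * (c ^+ 2 + s ^+ 2)); first by rewrite cs mulr1.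
  transitivity ((A u 0 * c + S u 0 * s) * s + (S u 0 * c + - A u 0 * s) * c).
    by ring.
  by rewrite E1' E2' mul0r addr0.
Qed.

End OU_stationary_charfun.

Theorem theorem2p3 (R : realType) (d : measure_display) (T : measurableType d)
    (P : probability T R) (lambda alpha theta : R)
    (lambda_gt0 : 0 < lambda) (alpha_gt0 : 0 < alpha) (theta_gt0 : 0 < theta)
    (N : R -> {RV P >-> nat}) (xi : nat -> {RV P >-> R})
    (N_poisson : poisson_process alpha N)
    (xi_iid : iid_exponential theta xi)
    (N_xi_indep : indep_classes P
       (process_sigma_algebra [set t : R | 0 <= t] N)
       (process_sigma_algebra [set: nat] xi))
    (sigma2 : R -> {RV P >-> R})
    (sigma2_solution : OU_solution lambda (compound_poisson N xi) sigma2)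
    (sigma2_stationary : stationary sigma2) :
  forall t : R, 0 <= t -> is_gamma_law alpha theta (distribution P (sigma2 t)).
Proof.
move=> t t_ge0 u; rewrite cpowR_1subi.
have mlin (f : R -> R) : measurable_fun setT f ->
    measurable_fun setT (fun x : R => f (u * x)).
  move=> mf; have mq : measurable_fun setT (fun x : R => u * x).
    exact: measurable_funM.
  exact: (measurableT_comp mf mq).
(* Stationarity moves the integral from time [t] to time [0]; the added [0] is the phase at which
   the solution is stated. *)
have E (f : R -> R) : measurable_fun setT f -> (forall x, `|f x| <= 1) ->
    \int[distribution P (sigma2 t)]_x f (u * x) =
    \int[P]_w f (u * sigma2 0 w + 0).
  move=> mf f1; under [RHS]eq_Rintegral do rewrite addr0.
  rewrite -(stationary_Rintegral _ _ (fun x => f (u * x)) 1 t)//; last first.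
    exact: mlin.
  rewrite /Rintegral; congr fine.
  rewrite (integral_distribution (X := sigma2 t)
    (f := fun x => (f (u * x))%:E))//.
    by apply/measurable_EFinP; exact: mlin.
  apply: (@bounded_integrable _ _ _ _ _ 1) => //.
  exact: (measurableT_comp (mlin _ mf)).
rewrite /charfun (E cos measurable_cos (@cos_max R)).
rewrite (E sin measurable_sin (@sin_max R)).
have [-> ->] := OU_charfun_solution P lambda alpha theta lambda_gt0 alpha_gt0
  theta_gt0 N xi N_poisson xi_iid N_xi_indep sigma2 sigma2_solution
  sigma2_stationary u.
by [].
Qed.
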